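(* Let $A_1>0$ and $A_2>0$ be constants. Let $s_1>0$ and $s_2>0$ be such that $0<s_1<\tau_1$ and $0<s_2<\tau_2$. Assume that $2\le p_1,q_1\le+\infty$ and $2\le p_2,q_2\le+\infty$ are such that $s_1+d(1/2-1/p_1)>0$ and $s_2+1/2-1/p_2>0$, and let $s>0$ be defined by $\frac1s=\frac1{d+1}\left(\frac d{s_1}+\frac1{s_2}\right)$. Consider the linear estimator $$\hat f^{\,l}_{j_1,m_2}(t,\underline x)=\sum_{j=-1}^{j_1}\sum_{|\lambda|=j}\sum_{m=-1}^{m_2}\sum_{\ell=0}^{2^m-1}y_{\lambda,m,\ell}\,\tilde\psi_{m,\ell}(t)\psi_\lambda(\underline x),\qquad t\in T,\ \underline x\in\mathcal X,$$ and let $j_1=j_1(\epsilon)$ and $m_2=m_2(\epsilon)$ be the largest integers such that $$2^{j_1(\epsilon)+1}\le\big\lfloor\epsilon^{-\frac{2s}{(2s+d+1)s_1}}\big\rfloor,\qquad 2^{m_2(\epsilon)+1}\le\big\lfloor\epsilon^{-\frac{2s}{(2s+d+1)s_2}}\big\rfloor .$$ Then there exists a constant $C>0$, independent of $\epsilon$, such that $$\sup_{f\in\mathbf B^{s_1,s_2}_{p,q}(A_1,A_2)}E\big\|\hat f^{\,l}_{j_1(\epsilon),m_2(\epsilon)}-f\big\|^2_{L^2(T\times\mathcal X)}\ \le\ C\,\epsilon^{\frac{4s}{2s+d+1}}$$ for all sufficiently small $\epsilon>0$.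
   Context: Setting. $d\ge1$, $T=[0,1]$ (time), $\mathcal X=[0,1]^d$ (space). One observes, with noise level $\epsilon>0$, the model $dY_\epsilon(t,\underline x)=f(t,\underline x)\,d\underline x+\epsilon\,dW(t,\underline x)$, $f\in L^2(T\times\mathcal X)$ unknown, understood as follows: for every $g\in L^2(T\times\mathcal X)$ one observes $\int g\,dY=\int_{T\times\mathcal X}g f\,dt\,d\underline x+\epsilon\int g\,dW$, where $(\int g\,dW)_{g\in L^2(T\times\mathcal X)}$ is a centered Gaussian family with $E(\int g_1dW\int g_2dW)=\int_{T\times\mathcal X}g_1g_2\,dt\,d\underline x$. Wavelets (periodic in each argument; primary resolution levels equal to $0$). $(\psi_\lambda)_{\lambda\in\Lambda}$ is a periodic $d$-dimensional tensor-product compactly supported orthonormal wavelet basis of $L^2(\mathcal X)$ built from a one-dimensional scaling function $\phi$ and wavelet $\psi$ that are $\tau_1$-times continuously differentiable (a standard wavelet basis if $d=1$). The index $\lambda$ collects scale and location; $|\lambda|=j$ means scale $j$; $\Lambda=\{\lambda:|\lambda|=j,\ j\ge-1\}$, where by convention the functions $\psi_\lambda$ with $|\lambda|=-1$ denote the scaling functions at level $0$. The span $V_j$ of the scaling functions at scale $j$ has dimension $2^{jd}$, and $(\psi_\lambda)_{|\lambda|=j}$, $j\ge 0$, is an orthonormal basis of the orthogonal complement of $V_j$ in $V_{j+1}$. Similarly $(\tilde\psi_{m,\ell})_{m\ge-1,\ 0\le\ell\le2^m-1}$ is a periodic one-dimensional compactly supported orthonormal wavelet basis of $L^2(T)$ built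 from $\tilde\phi,\tilde\psi$ that are $\tau_2$-times continuously differentiable; by convention $m=-1$ refers to the scaling function at level $0$ (the single index $\ell=0$). Coefficients. For $f$ with $f(t,\cdot)\in L^2(\mathcal X)$ for each $t$: $\alpha_\lambda(t)=\langle f(t,\cdot),\psi_\lambda\rangle_{L^2(\mathcal X)}$ and $\tilde\alpha_{\lambda,m,\ell}=\langle\alpha_\lambda,\tilde\psi_{m,\ell}\rangle_{L^2(T)}=\int_{T\times\mathcal X}f(t,\underline x)\tilde\psi_{m,\ell}(t)\psi_\lambda(\underline x)\,dt\,d\underline x$. Observed coefficients. $y_{\lambda,m,\ell}=\int_{T\times\mathcal X}\tilde\psi_{m,\ell}(t)\psi_\lambda(\underline x)\,dY(t,\underline x)=\tilde\alpha_{\lambda,m,\ell}+\epsilon z_{\lambda,m,\ell}$, where the $z_{\lambda,m,\ell}$ are i.i.d. standard Gaussian. Norms (sums replaced by maxima when an index is $+\infty$): $$\|f(t,\cdot)\|^{s_1}_{p_1,q_1}=\Big(\sum_{j=-1}^{\infty}2^{j(s_1+d(1/2-1/p_1))q_1}\big(\sum_{|\lambda|=j}|\alpha_\lambda(t)|^{p_1}\big)^{q_1/p_1}\Big)^{1/q_1},$$ $$\|\alpha_\lambda\|^{s_2}_{p_2,q_2}=\Big(\sum_{m=-1}^{\infty}2^{m(s_2+1/2-1/p_2)q_2}\big(\sum_{\ell=0}^{2^m-1}|\tilde\alpha_{\lambda,m,\ell}|^{p_2}\big)^{q_2/p_2}\Big)^{1/q_2}.$$ Ball. With $p=(p_1,p_2)$,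 $q=(q_1,q_2)$ and a fixed family of positive constants $(A_\lambda)_{\lambda\in\Lambda}$ satisfying $\sum_{j\ge-1}\sum_{|\lambda|=j}A_\lambda^2\le A_2^2$ (the dependence on $(A_\lambda)$ is suppressed in the notation), $$\mathbf B^{s_1,s_2}_{p,q}(A_1,A_2)=\Big\{f\in L^2(T\times\mathcal X):\ \sup_{t\in T}\|f(t,\cdot)\|^{s_1}_{p_1,q_1}\le A_1\ \text{and}\ \|\alpha_\lambda\|^{s_2}_{p_2,q_2}\le A_\lambda\ \text{for all }\lambda\in\Lambda\Big\}.$$ *)

(* Defs.v *)
From HB Require Import structures.
From mathcomp Require Import all_boot all_order all_algebra.
From mathcomp Require Import all_classical all_reals all_analysis.

Set Implicit Arguments.
Unset Strict Implicit.
Unset Printing Implicit Defensive.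
Import Order.TTheory GRing.Theory Num.Theory.
Import numFieldTopology.Exports numFieldNormedType.Exports.

Local Open Scope classical_set_scope.
Local Open Scope ring_scope.

(** * Lebesgue measure on [0,1] and [0,1]^d

    Functions on [0,1]^d are functions on all of R^d (as tuples); the measures
    below are carried by the cube, so values outside it are irrelevant. *)

Section lebesgue_unit.
Variable R : realType.

Definition lebesgue01 : set (measurableTypeR R) -> \bar R :=
  mrestr (@lebesgue_measure R) (measurable_itv `[0, 1]).

HB.instance Definition _ := Measure.on lebesgue01.

Lemma lebesgue01_setT : lebesgue01 [set: _] = 1%E.
Proof.
by rewrite /lebesgue01 /mrestr setTI lebesgue_measure_itv/= lte01 oppr0 adde0.
Qed.

HB.instance Definition _ :=
  @Measure_isProbability.Build _ _ R lebesgue01 lebesgue01_setT.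

Definition tcons d (z : measurableTypeR R * d.-tuple (measurableTypeR R)) :
  d.+1.-tuple (measurableTypeR R) := [the d.+1.-tuple _ of z.1 :: z.2].

Lemma measurable_tcons d : measurable_fun [set: _] (@tcons d).
Proof. exact: (measurable_cons measurable_fst measurable_snd). Qed.

HB.instance Definition _ d :=
  isMeasurableFun.Build _ _ _ _ (@tcons d) (@measurable_tcons d).

(* The d-fold product of [lebesgue01], transported to tuples. *)
Fixpoint lebesgue_cube d : probability (d.-tuple (measurableTypeR R)) R :=
  match d with
  | 0 => dirac [tuple]
  | n.+1 => distribution (lebesgue01 \x lebesgue_cube n)%E (@tcons n)
  end.

End lebesgue_unit.

(** * L^2 *)

Section L2.
Context {dT : measure_display} {T : measurableType dT} {R : realType}.
Variable mu : {measure set T -> \bar R}.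

Definition inner (f g : T -> R) : R := \int[mu]_x (f x * g x).

Definition sqnorm (f : T -> R) : \bar R := (\int[mu]_x ((f x) ^+ 2)%:E)%E.

Definition orthonormal_basis (I : eqType) (b : I -> T -> R) : Prop :=
  [/\ forall i, b i \in Lfun mu 2%:E,
      forall i j, inner (b i) (b j) = (i == j)%:R &
      forall f, f \in Lfun mu 2%:E -> forall e : R, 0 < e ->
        exists (r : seq I) (c : I -> R),
          (sqnorm (fun x => f x - \sum_(i <- r) c i * b i x)%R < e%:E)%E].

End L2.

(** * Wavelets *)

Section line_wavelets.
Variable R : realType.
Implicit Types (g phi psi : R -> R).

Definition continuously_differentiable (k : nat) g : Prop :=
  (forall n x, (n < k)%N -> derivable (g^`(n))%classic x 1) /\
  (forall n, (n <= k)%N -> continuous (g^`(n))%classic).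

Definition compact_support g : Prop :=
  exists K : R, forall x, K < `|x| -> g x = 0.

Definition dilate g (j : nat) (k : int) (x : R) : R :=
  Num.sqrt (2 ^+ j) * g (2 ^+ j * x - k%:~R).

(* Index 0 stands for the scaling functions at level 0, index j.+1 for the
   wavelets at scale j. *)
Definition line_family phi psi (i : nat * int) : R -> R :=
  if i.1 is j.+1 then dilate psi j i.2 else dilate phi 0 i.2.

(* The fsbig sums over [int] below have finitely many nonzero terms, since the
   functions involved have compact support. *)
Definition refinable phi g : Prop :=
  exists h : int -> R,
    forall x, g x = \sum_(k \in [set: int]) h k * dilate phi 1 k x.

(* [phi], [psi] are the scaling function and the wavelet of a compactly
   supported orthonormal wavelet basis of L^2(R) of regularity [tau]. *)
Definition wavelet_pair (tau : nat) phi psi : Prop :=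
  [/\ continuously_differentiable tau phi /\ continuously_differentiable tau psi,
      compact_support phi /\ compact_support psi,
      refinable phi phi /\ refinable phi psi &
      @orthonormal_basis _ (measurableTypeR R) _ (@lebesgue_measure R) _
        (line_family phi psi)].

Definition periodized g (j k : nat) (x : R) : R :=
  \sum_(n \in [set: int]) dilate g j k%:Z (x + n%:~R).

End line_wavelets.

(** Scales run over -1, 0, 1, ... in the mathematics and are stored shifted by
    one: the natural number [n] stands for the scale [n - 1], so that [n = 0]
    is the level of the scaling functions. Since [0.-1 = 0], [2 ^ n.-1] is the
    number of translates per coordinate in all cases, [n = 0] included. *)

Definition time_index (n : nat) : finType := 'I_(2 ^ n.-1).

(* Pairs (e, k) of a type and a location: coordinate [i] carries the scaling
   function if [e i = false], the wavelet if [e i = true]. At the level of the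
   scaling functions [e = 0] is the only type; at a scale j >= 0 all 2^d - 1
   types other than 0 occur. *)
Definition space_index (d n : nat) : finType :=
  {u : {ffun 'I_d -> bool} * {ffun 'I_d -> 'I_(2 ^ n.-1)}
     | (u.1 == [ffun=> false]) == (n == 0%N)}.

Section periodic_wavelets.
Variables (R : realType) (phi psi : R -> R).

Definition time_wavelet (n : nat) (k : time_index n) : R -> R :=
  periodized (if n == 0%N then phi else psi) n.-1 k.

Definition space_wavelet d n (l : space_index d n)
    (x : d.-tuple (measurableTypeR R)) : R :=
  \prod_(i < d) periodized (if (val l).1 i then psi else phi)
                  n.-1 ((val l).2 i) (tnth x i).

(* That periodizing (and tensorizing) a wavelet pair yields an orthonormal
   basis is classical; a periodic wavelet basis is taken here to be a wavelet
   pair together with that property. *)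
Definition time_wavelet_basis (tau : nat) : Prop :=
  wavelet_pair tau phi psi /\
  @orthonormal_basis _ (measurableTypeR R) _ (@lebesgue01 R)
    {n : nat & time_index n} (fun i => time_wavelet (tagged i)).

Definition space_wavelet_basis (d tau : nat) : Prop :=
  wavelet_pair tau phi psi /\
  orthonormal_basis (lebesgue_cube R d)
    (fun i : {n : nat & space_index d n} => space_wavelet (tagged i)).

End periodic_wavelets.

(** * Besov sequence norms; the exponents p, q range over [2, +oo] *)

Section besov.
Variable R : realType.
Local Open Scope ereal_scope.

(* 1/p, with 1/oo = 0 *)
Definition expinv (p : \bar R) : R := if p is r%:E then r^-1%R else 0%R.

Definition lp_norm (p : \bar R) (I : finType) (a : I -> R) : R :=
  match p with
  | r%:E => ((\sum_i `|a i| `^ r) `^ r^-1)%R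
  | +oo => (\big[Num.max/0]_i `|a i|)%R
  | -oo => 0%R
  end.

Definition besov_norm (w : R) (p q : \bar R) (I : nat -> finType)
    (a : forall n, I n -> R) : \bar R :=
  let u n := (2 `^ ((n%:R - 1) * w) * lp_norm p (a n))%R in
  match q with
  | r%:E => (\sum_(n <oo) (u n `^ r)%:E) `^ r^-1
  | +oo => ereal_sup (range (fun n => (u n)%:E))
  | -oo => 0
  end.

End besov.

(** * The ball, the observations and the estimator *)

Section model.
Variables (R : realType) (d : nat).
Variables (phi psi phit psit : R -> R).

Local Notation T := (measurableTypeR R).
Local Notation X := (d.-tuple (measurableTypeR R)).

Definition lebesgueTX : {measure set (T * X) -> \bar R} :=
  (@lebesgue01 R \x lebesgue_cube R d)%E.

Definition alpha (f : T * X -> R) n (l : space_index d n) (t : R) : R :=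
  inner (lebesgue_cube R d) (fun x => f (t, x)) (space_wavelet phi psi l).

Definition alphat (f : T * X -> R) n (l : space_index d n)
    m (k : time_index m) : R :=
  inner (@lebesgue01 R) (alpha f l) (time_wavelet phit psit k).

Definition besov_ball (s1 s2 : R) (p1 p2 q1 q2 : \bar R) (A1 : R)
    (A : forall n, space_index d n -> R) : set (T * X -> R) :=
  [set f | [/\ f \in Lfun lebesgueTX 2%:E,
    forall t, t \in `[0, 1] ->
      (fun x => f (t, x)) \in Lfun (lebesgue_cube R d) 2%:E,
    (ereal_sup [set besov_norm (s1 + d%:R * (2^-1 - expinv p1)) p1 q1
                      (fun n (l : space_index d n) => alpha f l t)
               | t in `[0%R, 1%R]] <= A1%:E)%E &
    forall n (l : space_index d n),
      (besov_norm (s2 + 2^-1 - expinv p2) p2 q2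
         (fun m (k : time_index m) => alphat f l k) <= (A n l)%:E)%E]].

Definition tensor n (l : space_index d n) m (k : time_index m)
    (z : T * X) : R :=
  time_wavelet phit psit k z.1 * space_wavelet phi psi l z.2.

(* Number of scales from -1 to j. *)
Definition nscales (j : int) : nat := if (j + 2)%R is Posz n then n else 0%N.

(* [Y g] is the observed value of the integral of g against dY. *)
Definition linear_estimator (Y : (T * X -> R) -> R) (j1 m2 : int)
    (z : T * X) : R :=
  \sum_(n < nscales j1) \sum_(l : space_index d n)
    \sum_(m < nscales m2) \sum_(k : time_index m)
      Y (tensor l k) * tensor l k z.

Section noise.
Context {dO : measure_display} {Omega : measurableType dO}.
Variable P : probability Omega R.

(* Normal law with mean m and standard deviation s >= 0; the library's
   [normal_prob] is not the point mass at m when s = 0. *)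
Definition gaussian_law (m s : R) : set T -> \bar R :=
  if s == 0 then dirac m else normal_prob m s.

Definition gaussian_rv (Z : Omega -> R) : Prop :=
  exists m s : R, 0 <= s /\
    forall B : set T, measurable B -> P (Z @^-1` B) = gaussian_law m s B.

Definition white_noise (W : (T * X -> R) -> {RV P >-> R}) : Prop :=
  [/\ forall (n : nat) (g : 'I_n -> T * X -> R) (c : 'I_n -> R),
        (forall i, g i \in Lfun lebesgueTX 2%:E) ->
        gaussian_rv (fun w => \sum_(i < n) c i * W (g i) w),
      forall g, g \in Lfun lebesgueTX 2%:E -> ('E_P[W g] = 0)%E &
      forall g1 g2, g1 \in Lfun lebesgueTX 2%:E ->
        g2 \in Lfun lebesgueTX 2%:E ->
        ('E_P[W g1 \* W g2] = (inner lebesgueTX g1 g2)%:E)%E].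

Definition observation (eps : R) (W : (T * X -> R) -> {RV P >-> R})
    (f : T * X -> R) (w : Omega) (g : T * X -> R) : R :=
  inner lebesgueTX g f + eps * W g w.

Definition risk (eps : R) (W : (T * X -> R) -> {RV P >-> R}) (j1 m2 : int)
    (f : T * X -> R) : \bar R :=
  (\int[P]_w sqnorm lebesgueTX
     (linear_estimator (observation eps W f w) j1 m2 \- f)%R)%E.

End noise.
End model.

Definition largest_int (Q : int -> Prop) (j : int) : Prop :=
  Q j /\ forall k, Q k -> k <= j.

(* Main.v *)
(** Bias-variance decomposition: expanding the squared error in the orthonormal
    family of tensor wavelets, the noise contributes exactly eps^2 times the
    number of retained coefficients, about 2^(j1 d + m2), and the bias is the
    squared distance of f to its projection. By Tonelli, that distance is
    computed first in x at each fixed t, where the uniform Besov bound controls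
    the discarded spatial scales by 2^(-2 s1 j1), and then in t for each retained
    alpha_lambda, where the discarded time scales contribute
    A_lambda^2 2^(-2 s2 m2), summable in lambda. Since p >= 2, the Besov
    conditions bound l2 norms scale by scale. The choice of j1 and m2 makes the
    three terms of order eps^(4s/(2s+d+1)). *)

Require Import Defs.
From HB Require Import structures.
From mathcomp Require Import all_boot all_order all_algebra.
From mathcomp Require Import all_classical all_reals all_analysis.
From mathcomp Require Import measurable_realfun ring lra.
Set Implicit Arguments.
Unset Strict Implicit.
Unset Printing Implicit Defensive.
Import Order.TTheory GRing.Theory Num.Theory.
Import numFieldTopology.Exports numFieldNormedType.Exports.
Local Open Scope classical_set_scope.
Local Open Scope ring_scope.

Section square_integrable.
Context {dT : measure_display} {T : measurableType dT} {R : realType}.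
Variable mu : {measure set T -> \bar R}.
Implicit Types f g h : T -> R.
Local Notation L2 := (Lfun mu 2%:E).

Lemma Lfun2_measurable f : f \in L2 -> measurable_fun setT f.
Proof. by move=> /sub_Lfun_mfun; rewrite inE. Qed.

Lemma sqnorm_ge0 f : (0 <= sqnorm mu f)%E.
Proof. by apply: integral_ge0 => x _; rewrite lee_fin sqr_ge0. Qed.

Lemma Lfun2P f :
  f \in L2 <-> measurable_fun setT f /\ (sqnorm mu f < +oo)%E.
Proof.
split=> [f2|[mf foo]].
  have mf2 : measurable_fun setT (fun x => (f x ^+ 2)%:E).
    by apply/measurable_EFinP/measurable_funX; exact: Lfun2_measurable.
  split; first exact: Lfun2_measurable.
  have /integrableP[_] := Lfun2_integrable_sqr f2.
  apply: le_lt_trans; apply: ge0_le_integral => //.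
  - by move=> x _; rewrite lee_fin sqr_ge0.
  - exact: measurableT_comp.
  - by move=> x _; rewrite gee0_abs// lee_fin sqr_ge0.
rewrite inE; apply/andP; split; first by rewrite inE.
rewrite inE/= /finite_norm unlock poweR_lty//.
rewrite (le_lt_trans _ foo)// le_eqVlt; apply/orP; left; apply/eqP.
apply: eq_integral => x _.
by rewrite /= powR_mulrn// -normrX ger0_norm// sqr_ge0.
Qed.

Lemma inner_integrable f g : f \in L2 -> g \in L2 ->
  mu.-integrable setT (fun x => (f x * g x)%:E).
Proof. by move=> f2 g2; apply/Lfun1_integrable; exact: Lfun2_mul_Lfun1. Qed.

Lemma sqnorm_inner f : f \in L2 -> sqnorm mu f = (inner mu f f)%:E.
Proof.
move=> f2; rewrite /inner /Rintegral fineK; first exact: eq_integral.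
by apply: integrable_fin_num => //; exact: inner_integrable.
Qed.

Lemma innerC f g : inner mu f g = inner mu g f.
Proof. by apply: eq_Rintegral => x _; rewrite mulrC. Qed.

Lemma Lfun2_lin (a : R) f g : f \in L2 -> g \in L2 ->
  (fun x => a * f x + g x) \in L2.
Proof.
move=> f2 g2; have p1 : (1 <= 2%:E :> \bar R)%E by rewrite lee_fin ler1n.
exact: (Lfun_submod_closed mu p1).2 a _ _ f2 g2.
Qed.

Lemma Lfun2_0 : (fun=> 0) \in L2.
Proof.
have p1 : (1 <= 2%:E :> \bar R)%E by rewrite lee_fin ler1n.
exact: (Lfun_submod_closed mu p1).1.
Qed.

Lemma Lfun2_sum (I : eqType) (r : seq I) (c : I -> R) (b : I -> T -> R) :
  {in r, forall i, b i \in L2} -> (fun x => \sum_(i <- r) c i * b i x) \in L2.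
Proof.
elim: r => [_|i r IHr ib].
  by under eq_fun do rewrite big_nil; exact: Lfun2_0.
under eq_fun do rewrite big_cons; apply: Lfun2_lin.
  by apply: ib; rewrite mem_head.
by apply: IHr => j jr; apply: ib; rewrite in_cons jr orbT.
Qed.

Lemma Lfun2B f g : f \in L2 -> g \in L2 -> (fun x => f x - g x) \in L2.
Proof.
move=> f2 g2; under eq_fun do rewrite addrC -mulN1r; exact: Lfun2_lin.
Qed.

Lemma inner_linl (a : R) f g h : f \in L2 -> g \in L2 -> h \in L2 ->
  inner mu (fun x => a * f x + g x) h = a * inner mu f h + inner mu g h.
Proof.
move=> f2 g2 h2; rewrite /inner.
under eq_Rintegral do rewrite mulrDl -mulrA.
rewrite RintegralD//; last 2 first.
- rewrite /comp; under eq_fun do rewrite EFinM.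
  by apply: integrableZl => //; exact: inner_integrable.
- exact: inner_integrable.
by rewrite RintegralZl//; exact: inner_integrable.
Qed.

Lemma inner0l h : inner mu (fun=> 0) h = 0.
Proof.
rewrite /inner /Rintegral integral0_eq// => x _; by rewrite mul0r.
Qed.

Lemma inner_suml (I : eqType) (r : seq I) (c : I -> R) (b : I -> T -> R) h :
  {in r, forall i, b i \in L2} -> h \in L2 ->
  inner mu (fun x => \sum_(i <- r) c i * b i x) h
  = \sum_(i <- r) c i * inner mu (b i) h.
Proof.
move=> + h2; elim: r => [_|i r IHr ib].
  by under eq_fun do rewrite big_nil; rewrite inner0l big_nil.
have ib' : {in r, forall i, b i \in L2}.
  by move=> j jr; apply: ib; rewrite in_cons jr orbT.
under eq_fun do rewrite big_cons.
rewrite inner_linl//; first by rewrite IHr// big_cons.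
- by apply: ib; rewrite mem_head.
- exact: Lfun2_sum.
Qed.

Lemma innerBl f g h : f \in L2 -> g \in L2 -> h \in L2 ->
  inner mu (fun x => f x - g x) h = inner mu f h - inner mu g h.
Proof.
move=> f2 g2 h2; under eq_fun do rewrite addrC -mulN1r.
by rewrite inner_linl// mulN1r addrC.
Qed.

Lemma sqnorm_sub_orthonormal (I : eqType) (r : seq I) (b : I -> T -> R)
    (c : I -> R) f : uniq r ->
  (forall i, b i \in L2) -> (forall i j, inner mu (b i) (b j) = (i == j)%:R) ->
  f \in L2 ->
  sqnorm mu (fun x => f x - \sum_(i <- r) c i * b i x) =
  (inner mu f f - \sum_(i <- r) inner mu f (b i) ^+ 2
   + \sum_(i <- r) (c i - inner mu f (b i)) ^+ 2)%:E.
Proof.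
move=> ur b2 bo f2; pose h := fun x => \sum_(i <- r) c i * b i x.
have h2 : h \in L2 by apply: Lfun2_sum => i _.
have hb i : i \in r -> inner mu h (b i) = c i.
  move=> ir; rewrite inner_suml//.
  rewrite (bigD1_seq i)//= bo eqxx mulr1 big1 ?addr0// => j ji.
  by rewrite bo (negbTE ji) mulr0.
have fh : inner mu f h = \sum_(i <- r) c i * inner mu f (b i).
  rewrite innerC inner_suml//.
  by under eq_bigr do rewrite innerC.
have hh : inner mu h h = \sum_(i <- r) c i ^+ 2.
  rewrite {1}/h inner_suml//.
  rewrite big_seq [RHS]big_seq; apply: eq_bigr => i ir.
  by rewrite innerC hb.
have fh2 : (fun x => f x - h x) \in L2 by exact: Lfun2B.
rewrite sqnorm_inner//; congr EFin.
rewrite innerBl// (innerC f) (innerC h) !innerBl//.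
rewrite (innerC h f) fh hh.
under [X in _ = _ + X]eq_bigr do rewrite sqrrB.
by rewrite big_split sumrB/= sumrMnl; ring.
Qed.

Lemma parseval_le (I : eqType) (b : I -> T -> R) f (B : R) :
  orthonormal_basis mu b -> f \in L2 ->
  (forall r : seq I, uniq r -> \sum_(i <- r) inner mu f (b i) ^+ 2 <= B) ->
  inner mu f f <= B.
Proof.
move=> [b2 bo bc] f2 fB; apply/ler_addgt0Pr => e e0.
have [r [c]] := bc f f2 e e0.
pose c' i := c i *+ count_mem i r.
have -> : (fun x => f x - \sum_(i <- r) c i * b i x) =
    (fun x => f x - \sum_(i <- undup r) c' i * b i x).
  apply/funext => x; congr (_ - _); rewrite -big_undup_iterop_count.
  apply: eq_bigr => i _; rewrite /c' mulrnAl.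
  by elim: (count_mem i r) => // -[|n] // IHn; rewrite mulrS -IHn.
rewrite sqnorm_sub_orthonormal ?undup_uniq// lte_fin => fe.
have := fB _ (undup_uniq r).
have : 0 <= \sum_(i <- undup r) (c' i - inner mu f (b i)) ^+ 2.
  by apply: sumr_ge0 => i _; exact: sqr_ge0.
by move: fe; lra.
Qed.

Lemma sqr_inner_le_sqnorm (b f : T -> R) : b \in L2 -> inner mu b b = 1 ->
  f \in L2 -> ((inner mu f b ^+ 2)%:E <= sqnorm mu f)%E.
Proof.
move=> b2 b1 f2; rewrite sqnorm_inner// lee_fin.
have bo (i j : unit) : inner mu b b = (i == j)%:R by case: i j => -[].
have := @sqnorm_sub_orthonormal unit [:: tt] (fun=> b) (fun=> inner mu f b) f
  isT (fun=> b2) bo f2.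
rewrite !big_seq1 subrr expr0n addr0 => E.
by rewrite -subr_ge0 -lee_fin -E; exact: sqnorm_ge0.
Qed.

End square_integrable.

Section scales.
Variable I : nat -> finType.

Definition scales (N : nat) : seq {n : nat & I n} :=
  [seq Tagged I l | n <- iota 0 N, l <- enum (I n)].

Lemma mem_scales N (i : {n : nat & I n}) : (i \in scales N) = (tag i < N)%N.
Proof.
apply/allpairsPdep/idP => [[n [l [nN _ ->]]]|iN].
  by rewrite mem_iota in nN.
exists (tag i), (tagged i); split; first by rewrite mem_iota.
  by rewrite mem_enum.
by case: i iN.
Qed.

Lemma uniq_scales N : uniq (scales N).
Proof.
apply: allpairs_uniq_dep; first exact: iota_uniq.
  by move=> n _; exact: enum_uniq.
by move=> [n l] [m k] _ _.
Qed.

Lemma sum_scales (V : nmodType) N (F : {n : nat & I n} -> V) :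
  \sum_(i <- scales N) F i = \sum_(n < N) \sum_(l : I n) F (Tagged I l).
Proof.
rewrite big_allpairs_dep -{1}[N]subn0 -/(index_iota 0 N) big_mkord.
by apply: eq_bigr => n _; rewrite big_enum.
Qed.

Lemma sum_scales_ge (R : numDomainType) (r : seq {n : nat & I n})
    (F : {n : nat & I n} -> R) : uniq r -> (forall i, 0 <= F i) ->
  exists M0, forall M, (M0 <= M)%N -> \sum_(i <- r) F i <= \sum_(i <- scales M) F i.
Proof.
move=> ur F0; exists (\max_(i <- r) (tag i).+1) => M rM.
rewrite [leRHS](bigID (mem r))/= -[in leRHS]big_filter.
rewrite [X in _ <= X + _](perm_big r)/=; first by rewrite lerDl sumr_ge0.
apply: uniq_perm => //; first exact/filter_uniq/uniq_scales.
move=> i; rewrite mem_filter mem_scales; apply/andb_idr => ir.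
by rewrite (leq_trans _ rM)//; apply: (@leq_bigmax_seq _ _ xpredT (fun i => (tag i).+1)).
Qed.

End scales.

Section parseval_scales.
Context {dT : measure_display} {T : measurableType dT} {R : realType}.
Variables (mu : {measure set T -> \bar R}) (I : nat -> finType).
Variable b : forall n, I n -> T -> R.
Hypothesis bP : orthonormal_basis mu (fun i : {n : nat & I n} => b (tagged i)).

Lemma sqnorm_sub_scales_le (N : nat) (c : forall n, I n -> R) (f : T -> R) (B : R) :
  f \in Lfun mu 2%:E ->
  (forall M, \sum_(N <= n < M) \sum_(l : I n) inner mu f (b l) ^+ 2 <= B) ->
  (sqnorm mu (fun x => f x - \sum_(n < N) \sum_(l : I n) c _ l * b l x)%R <=
   (B + \sum_(n < N) \sum_(l : I n) (c _ l - inner mu f (b l)) ^+ 2)%:E)%E.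
Proof.
move=> f2 fB.
have [b2 bo _] := bP.
pose c' (i : {n : nat & I n}) := c _ (tagged i).
pose b' (i : {n : nat & I n}) := b (tagged i).
have -> : (fun x => f x - \sum_(n < N) \sum_(l : I n) c _ l * b l x) =
    (fun x => f x - \sum_(i <- scales I N) c' i * b' i x).
  by apply/funext => x; rewrite sum_scales.
rewrite sqnorm_sub_orthonormal ?uniq_scales// !sum_scales lee_fin lerD2r lerBlDr.
apply: (parseval_le bP f2) => r ur.
have F0 (i : {n : nat & I n}) : 0 <= inner mu f (b' i) ^+ 2 by exact: sqr_ge0.
have [M0 M0P] := sum_scales_ge ur F0.
apply: (le_trans (M0P (maxn M0 N) (leq_maxl _ _))).
rewrite sum_scales -(big_mkord xpredT (fun n => \sum_(l : I n) inner mu f (b l) ^+ 2)).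
rewrite (big_cat_nat (n := N))//= ?leq_maxr// big_mkord addrC lerD2r.
exact: fB.
Qed.

End parseval_scales.

Section besov_decay.
Variable R : realType.
Implicit Types (p q : \bar R).

Lemma scale_le_besov_norm (w A : R) p q (I : nat -> finType)
    (a : forall n, I n -> R) : 0 < A -> (2%:E <= q)%E ->
  (besov_norm w p q a <= A%:E)%E ->
  forall n, 2 `^ ((n%:R - 1) * w) * lp_norm p (a n) <= A.
Proof.
move=> A0 q2; rewrite /besov_norm.
pose u n := 2 `^ ((n%:R - 1) * w) * lp_norm p (a n); rewrite -/u.
have lp0 n : 0 <= lp_norm p (a n).
  case: p @u => [r| |]//=; first by rewrite powR_ge0.
  by apply/bigmax_geP; left.
have u0 n : 0 <= u n by rewrite mulr_ge0// powR_ge0.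
case: q q2 => [r| |]//; last first.
  by move=> _ uA n; rewrite -lee_fin (le_trans _ uA)//; apply: ereal_sup_ubound; exists n.
rewrite lee_fin => r2 uA n; have r0 : 0 < r by lra.
rewrite -/(u n) -lee_fin.
apply: le_trans uA.
have -> : (u n)%:E = (((u n `^ r)%:E) `^ r^-1)%E.
  by rewrite poweR_EFin -powRrM mulfV ?gt_eqF// powRr1.
have uS : ((u n `^ r)%:E <= \sum_(n <oo) (u n `^ r)%:E)%E.
  apply: le_trans (nneseries_lim_ge (m := 0) n.+1 _).
    rewrite big_nat_recr//= leeDr// sume_ge0// => i _.
    by rewrite lee_fin powR_ge0.
  by move=> i _ _; rewrite lee_fin powR_ge0.
apply: gt0_ler_poweR => //.
- by rewrite invr_ge0 ltW.
- by rewrite in_itv/= leey lee_fin powR_ge0.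
- by rewrite in_itv/= leey (le_trans _ uS)// lee_fin powR_ge0.
Qed.

(* With the threshold t = K^(-2/p) M^2, either a_i^2 <= t or
   a_i^2 <= a_i^p t^(1-p/2); this replaces Hoelder's inequality at the cost of
   a factor 2. *)
Lemma sum_sqr_le_lp_norm p (I : finType) (a : I -> R) (K M : R) :
  (2%:E <= p)%E -> 0 < K -> (#|I|%:R <= K) -> 0 < M -> lp_norm p a <= M ->
  \sum_i a i ^+ 2 <= 2 * (K `^ (1 - 2 * expinv p) * M ^+ 2).
Proof.
move=> p2 K0 IK M0.
case: p p2 => [r| |]// => [|_]; last first.
  rewrite /= mulr0 subr0 powRr1 ?(ltW K0)// => aM.
  apply: (@le_trans _ _ (K * M ^+ 2)); last first.
    by rewrite ler_peMl ?ler1n// mulr_ge0 ?sqr_ge0// (ltW K0).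
  apply: (@le_trans _ _ (\sum_(i : I) M ^+ 2)).
    apply: ler_sum => i _; rewrite -real_normK ?num_real// lerXn2r ?nnegrE//.
      exact: ltW.
    by apply: le_trans aM; exact: le_bigmax.
  by rewrite sumr_const -mulr_natl ler_wpM2r ?sqr_ge0.
rewrite lee_fin => r2 /= aM; have r0 : 0 < r by lra.
have aM' : \sum_i `|a i| `^ r <= M `^ r.
  have := @ge0_ler_powR R r (ltW r0) _ _ _ _ aM.
  rewrite -powRrM mulVf ?gt_eqF// powRr1; last by apply: sumr_ge0 => i _; exact: powR_ge0.
  by apply; rewrite nnegrE ?powR_ge0// ltW.
pose t := K `^ (- (2 / r)) * M ^+ 2.
have t0 : 0 < t by rewrite mulr_gt0 ?powR_gt0// exprn_gt0.
have at_ i : a i ^+ 2 <= t + `|a i| `^ r * t `^ (1 - r / 2).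
  have [ait|ait] := leP (a i ^+ 2) t.
    by rewrite (le_trans ait)// lerDl mulr_ge0// powR_ge0.
  have ai0 : 0 < `|a i|.
    rewrite normr_gt0; apply: contraTneq ait => ->.
    by rewrite expr0n -leNgt ltW.
  rewrite -[leLHS]add0r lerD ?(ltW t0)//.
  rewrite -real_normK ?num_real// -powR_mulrn//.
  rewrite -ler_pdivrMl ?powR_gt0// -powRN -powRD; last first.
    by rewrite (gt_eqF ai0) implybT.
  have -> : - r + 2 = 2 * (1 - r / 2) by field.
  rewrite powRrM powR_mulrn// real_normK ?num_real//.
  have -> : 1 - r / 2 = - (r / 2 - 1) by ring.
  rewrite !powRN lef_pV2 ?posrE ?powR_gt0// ?(lt_trans t0)//.
  have r21 : 0 <= r / 2 - 1 by lra.
  apply: (ge0_ler_powR r21); rewrite ?nnegrE ?sqr_ge0 ?(ltW t0)//.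
  exact: ltW.
apply: (@le_trans _ _ (\sum_i (t + `|a i| `^ r * t `^ (1 - r / 2)))).
  by apply: ler_sum => i _.
have tI : \sum_(i : I) t = #|I|%:R * t by rewrite sumr_const mulr_natl.
rewrite big_split/= tI -mulr_suml.
apply: (@le_trans _ _ (K * t + M `^ r * t `^ (1 - r / 2))).
  by apply: lerD; apply: ler_wpM2r; rewrite ?powR_ge0// ltW.
have Kt : K * t = K `^ (1 - 2 / r) * M ^+ 2.
  rewrite /t mulrA powRD; last by rewrite (gt_eqF K0) implybT.
  by rewrite powRr1// ltW.
have Mt : M `^ r * t `^ (1 - r / 2) = K * t.
  rewrite powRD; last by rewrite (gt_eqF t0) implybT.
  rewrite powRr1 ?(ltW t0)// mulrCA mulrC; congr (_ * _).
  rewrite /t powRM ?powR_ge0 ?sqr_ge0// -powRrM -powR_mulrn ?(ltW M0)// -powRrM.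
  rewrite mulrCA -powRD; last by rewrite (gt_eqF M0) implybT.
  have -> : r + 2 * - (r / 2) = 0 by field.
  have -> : - (2 / r) * - (r / 2) = 1 by field; rewrite gt_eqF.
  by rewrite powRr0 powRr1 ?mulr1// ltW.
by rewrite Mt -Kt mulr_natl mulr2n.
Qed.

Lemma besov_norm_decay (s A D : R) p q (I : nat -> finType)
    (a : forall n, I n -> R) :
  0 < A -> (2%:E <= p)%E -> (2%:E <= q)%E ->
  (forall n, #|I n|%:R <= 2 `^ (n%:R * D)) ->
  (besov_norm (s + D * (2^-1 - expinv p)) p q a <= A%:E)%E ->
  forall n, \sum_(l : I n) a n l ^+ 2 <=
    2 * 2 `^ (2 * (s + D * (2^-1 - expinv p))) * A ^+ 2 * (2 `^ (- (2 * s))) ^+ n.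
Proof.
move=> A0 p2 q2 ID; set w := s + _ => aA n.
have lpA := scale_le_besov_norm A0 q2 aA n.
have M0 : 0 < A / 2 `^ ((n%:R - 1) * w) by rewrite divr_gt0// powR_gt0.
have lpM : lp_norm p (a n) <= A / 2 `^ ((n%:R - 1) * w).
  by rewrite ler_pdivlMr ?powR_gt0// mulrC.
have two0 : (0 : R) < 2 by [].
have := sum_sqr_le_lp_norm p2 (powR_gt0 (n%:R * D) two0) (ID n) M0 lpM.
move=> /le_trans; apply; rewrite -!(mulrA 2) ler_wpM2l// le_eqVlt; apply/orP; left.
rewrite expr_div_n -!powR_mulrn ?powR_ge0 ?(ltW A0)// -!powRrM -powRN.
rewrite [X in X == _]mulrCA [X in _ == X]mulrAC [X in _ == X]mulrC -!powRD ?pnatr_eq0 ?implybT//.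
by apply/eqP; congr (_ * _ `^ _); rewrite /w; field.
Qed.
End besov_decay.

Section product_square_integrable.
Context {d1 d2 : measure_display} {T1 : measurableType d1}
  {T2 : measurableType d2} {R : realType}.
Variables (m1 : probability T1 R) (m2 : probability T2 R).
Local Notation m12 := (m1 \x m2)%E.
Implicit Types (a : T1 -> R) (b : T2 -> R) (f : T1 * T2 -> R).

Definition tensor_fun a b (z : T1 * T2) : R := a z.1 * b z.2.

Lemma measurable_tensor_fun a b : measurable_fun setT a ->
  measurable_fun setT b -> measurable_fun setT (tensor_fun a b).
Proof.
by move=> ma mb; apply: measurable_funM; apply: measurableT_comp.
Qed.

Lemma sqnorm_product f : measurable_fun setT f ->
  sqnorm m12 f = (\int[m1]_t sqnorm m2 (fun x => f (t, x)))%E.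
Proof.
move=> mf; rewrite /sqnorm fubini_tonelli1//.
  by apply/measurable_EFinP/measurable_funX.
by move=> z; rewrite lee_fin sqr_ge0.
Qed.

Lemma measurable_sqnorm_section f : measurable_fun setT f ->
  measurable_fun setT (fun t => sqnorm m2 (fun x => f (t, x))).
Proof.
move=> mf; apply: (measurable_fun_fubini_tonelli_F (fun z => (f z ^+ 2)%:E)).
  by apply/measurable_EFinP/measurable_funX.
by move=> z; rewrite lee_fin sqr_ge0.
Qed.

Lemma ae_Lfun2_section f : f \in Lfun m12 2%:E ->
  {ae m1, forall t, (fun x => f (t, x)) \in Lfun m2 2%:E}.
Proof.
move=> f2; have mf := Lfun2_measurable f2.
have := ae_integrable1 (Lfun2_integrable_sqr f2).
apply: filterS => t /integrableP[_ foo]; apply/Lfun2P; split.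
  exact: measurableT_comp.
apply: le_lt_trans foo; rewrite le_eqVlt; apply/orP; left; apply/eqP.
by apply: eq_integral => x _; rewrite gee0_abs// lee_fin sqr_ge0.
Qed.

Lemma sqnorm_tensor a b : a \in Lfun m1 2%:E -> b \in Lfun m2 2%:E ->
  sqnorm m12 (tensor_fun a b) = (sqnorm m1 a * sqnorm m2 b)%E.
Proof.
move=> a2 b2; have [[ma _] [mb _]] := ((Lfun2P _ _).1 a2, (Lfun2P _ _).1 b2).
rewrite sqnorm_product; last exact: measurable_tensor_fun.
have ma2 : measurable_fun setT (fun t => (a t ^+ 2)%:E).
  by apply/measurable_EFinP/measurable_funX.
have mb2 : measurable_fun setT (fun x => (b x ^+ 2)%:E).
  by apply/measurable_EFinP/measurable_funX.
rewrite -ge0_integralZr//.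
- apply: eq_integral => t _; rewrite /sqnorm /tensor_fun/=.
  under eq_integral do rewrite exprMn EFinM.
  by rewrite ge0_integralZl ?lee_fin ?sqr_ge0// => x _; rewrite lee_fin sqr_ge0.
- by move=> t _; rewrite lee_fin sqr_ge0.
- exact: sqnorm_ge0.
Qed.

Lemma Lfun2_tensor a b : a \in Lfun m1 2%:E -> b \in Lfun m2 2%:E ->
  tensor_fun a b \in Lfun m12 2%:E.
Proof.
move=> a2 b2; apply/Lfun2P; split.
  exact: measurable_tensor_fun (Lfun2_measurable a2) (Lfun2_measurable b2).
by rewrite sqnorm_tensor// !sqnorm_inner// -EFinM ltry.
Qed.

Lemma Lfun2_cst (c : R) : cst c \in Lfun m1 2%:E.
Proof. exact: Lfun_cst. Qed.

Definition section_coef f b (t : T1) : R := inner m2 (fun x => f (t, x)) b.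

Lemma integrable_section_product f b : f \in Lfun m12 2%:E ->
  b \in Lfun m2 2%:E ->
  m12.-integrable setT (fun z => (f z * b z.2)%:E).
Proof.
move=> f2 b2; have := inner_integrable f2 (Lfun2_tensor (Lfun2_cst 1) b2).
by apply: eq_integrable => // z _; rewrite /tensor_fun mul1r.
Qed.

Lemma measurable_section_coef f b : f \in Lfun m12 2%:E ->
  b \in Lfun m2 2%:E -> measurable_fun setT (section_coef f b).
Proof.
move=> f2 b2; apply: measurableT_comp => //.
exact: measurable_fubini_F (integrable_section_product f2 b2).
Qed.

Lemma Lfun2_section_coef f b : f \in Lfun m12 2%:E ->
  b \in Lfun m2 2%:E -> inner m2 b b = 1 ->
  section_coef f b \in Lfun m1 2%:E.
Proof.
move=> f2 b2 b1; have mf := Lfun2_measurable f2.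
have mc := measurable_section_coef f2 b2.
apply/Lfun2P; split => //.
have /Lfun2P[_] := f2; rewrite sqnorm_product//; apply: le_lt_trans.
apply: ae_ge0_le_integral => //.
- by move=> t _; rewrite lee_fin sqr_ge0.
- by apply/measurable_EFinP/measurable_funX.
- by move=> t _; exact: sqnorm_ge0.
- exact: measurable_sqnorm_section.
- have := ae_Lfun2_section f2; apply: filterS => t ft _.
  exact: sqr_inner_le_sqnorm.
Qed.

Lemma inner_tensor f a b : f \in Lfun m12 2%:E -> a \in Lfun m1 2%:E ->
  b \in Lfun m2 2%:E ->
  inner m12 (tensor_fun a b) f = inner m1 (section_coef f b) a.
Proof.
move=> f2 a2 b2; have mf := Lfun2_measurable f2.
have abf := inner_integrable (Lfun2_tensor a2 b2) f2.
rewrite /inner /Rintegral; congr fine.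
rewrite -integral12_prod_meas1//; apply: ae_eq_integral => //.
- exact: measurable_fubini_F abf.
- apply/measurable_EFinP/measurable_funM; first exact: measurable_section_coef.
  exact: (Lfun2_measurable a2).
- have := ae_Lfun2_section f2; apply: filterS => t ft _.
  rewrite /fubini_F/= mulrC EFinM.
  have fb := inner_integrable ft b2.
  rewrite /section_coef /inner /Rintegral fineK; last exact: integrable_fin_num.
  rewrite -integralZl//; apply: eq_integral => x _.
  by rewrite /tensor_fun/= -EFinM; congr EFin; ring.
Qed.

Lemma inner_tensor_tensor a a' b b' :
  a \in Lfun m1 2%:E -> a' \in Lfun m1 2%:E ->
  b \in Lfun m2 2%:E -> b' \in Lfun m2 2%:E ->
  inner m12 (tensor_fun a b) (tensor_fun a' b') = inner m1 a a' * inner m2 b b'.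
Proof.
move=> a2 a2' b2 b2'; rewrite inner_tensor//; last exact: Lfun2_tensor.
have bb' := inner_integrable b2 b2'.
rewrite /inner -[in RHS]RintegralZr//; last exact: inner_integrable.
apply: eq_Rintegral => t _; rewrite /section_coef /inner /tensor_fun/=.
under eq_Rintegral do rewrite -mulrA (mulrC (b' _)).
by rewrite RintegralZl//; ring.
Qed.

Variables (I J : nat -> finType).
Variables (a : forall m, J m -> T1 -> R) (b : forall n, I n -> T2 -> R).
Hypothesis aP : orthonormal_basis m1 (fun i : {m : nat & J m} => a (tagged i)).
Hypothesis bP : orthonormal_basis m2 (fun i : {n : nat & I n} => b (tagged i)).

Definition tensor_coef f n (l : I n) m (k : J m) : R :=
  inner m1 (section_coef f (b l)) (a k).

(* Completeness of the two factors is used one variable at a time; that of the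
   tensor product basis is never needed. *)
Lemma sqnorm_sub_projection_le f (N1 N2 : nat) (B1 : R) (B2 : forall n, I n -> R) :
  f \in Lfun m12 2%:E -> 0 <= B1 ->
  {ae m1, forall t, forall M,
    \sum_(N1 <= n < M) \sum_(l : I n) section_coef f (b l) t ^+ 2 <= B1} ->
  (forall n (l : I n) M,
    \sum_(N2 <= m < M) \sum_(k : J m) tensor_coef f l k ^+ 2 <= B2 _ l) ->
  (sqnorm m12 (fun z => f z - \sum_(n < N1) \sum_(l : I n)
      \sum_(m < N2) \sum_(k : J m) tensor_coef f l k * tensor_fun (a k) (b l) z)%R
   <= (B1 + \sum_(n < N1) \sum_(l : I n) B2 _ l)%:E)%E.
Proof.
move=> f2 B10 fB1 fB2.
have [a2 _ _] := aP; have [b2 bo _] := bP.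
have a2' m (k : J m) : a k \in Lfun m1 2%:E by exact: (a2 (Tagged J k)).
have b2' n (l : I n) : b l \in Lfun m2 2%:E by exact: (b2 (Tagged I l)).
have b1 n (l : I n) : inner m2 (b l) (b l) = 1.
  by have := bo (Tagged I l) (Tagged I l); rewrite eqxx.
have sc2 n (l : I n) : section_coef f (b l) \in Lfun m1 2%:E.
  exact: Lfun2_section_coef.
pose c n (l : I n) t := \sum_(m < N2) \sum_(k : J m) tensor_coef f l k * a k t.
have mc n (l : I n) : measurable_fun setT (c n l).
  apply: measurable_sum => m; apply: measurable_sum => k.
  by apply: measurable_funM => //; exact: (Lfun2_measurable (a2' m k)).
have msc n (l : I n) : measurable_fun setT (section_coef f (b l)).
  exact: (Lfun2_measurable (sc2 n l)).
set g := fun z : T1 * T2 => _.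
have gE t x : g (t, x) = f (t, x) - \sum_(n < N1) \sum_(l : I n) c n l t * b l x.
  congr (_ - _); apply: eq_bigr => n _; apply: eq_bigr => l _.
  rewrite mulr_suml; apply: eq_bigr => m _; rewrite mulr_suml.
  by apply: eq_bigr => k _; rewrite /tensor_fun mulrA.
have mg : measurable_fun setT g.
  apply: measurable_funB; first exact: (Lfun2_measurable f2).
  apply: measurable_sum => n; apply: measurable_sum => l.
  apply: measurable_sum => m; apply: measurable_sum => k.
  apply: measurable_funM => //.
  exact: measurable_tensor_fun (Lfun2_measurable (a2' m k)) (Lfun2_measurable (b2' n l)).
rewrite sqnorm_product//.
pose e n (l : I n) t := ((section_coef f (b l) t - c n l t) ^+ 2)%:E.
have e0 n (l : I n) t : (0 <= e n l t)%E by rewrite lee_fin sqr_ge0.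
have me n (l : I n) : measurable_fun setT (e n l).
  by apply/measurable_EFinP/measurable_funX/measurable_funB.
have mse (n : nat) : measurable_fun setT (fun t => \sum_(l : I n) e n l t)%E.
  by apply: emeasurable_sum => l.
have mE : measurable_fun setT (fun t => \sum_(n < N1) \sum_(l : I n) e n l t)%E.
  by apply: emeasurable_sum => n.
have se0 (n : nat) t : (0 <= \sum_(l : I n) e n l t)%E by exact: sume_ge0.
have E0 t : (0 <= \sum_(n < N1) \sum_(l : I n) e n l t)%E by apply: sume_ge0.
apply: (@le_trans _ _
   (\int[m1]_t (B1%:E + \sum_(n < N1) \sum_(l : I n) e n l t))%E).
  apply: ae_ge0_le_integral => //.
  - by move=> t _; exact: sqnorm_ge0.
  - exact: measurable_sqnorm_section.
  - by move=> t _; rewrite adde_ge0// lee_fin.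
  - exact: emeasurable_funD.
  - have := ae_Lfun2_section f2; apply: filterS2 fB1 => t ftB1 ft _.
    under [X in sqnorm _ X]eq_fun do rewrite gE.
    apply: le_trans (sqnorm_sub_scales_le bP (fun n l => c n l t) ft ftB1) _.
    rewrite EFinD -sumEFin leeD2l//; apply: lee_sum => n _.
    rewrite -sumEFin; apply: lee_sum => l _.
    by rewrite lee_fin -sqrrN opprB.
rewrite ge0_integralD//.
rewrite integral_cst// (_ : _ setT = 1%E); last exact: (probability_setT m1).
rewrite mule1 EFinD leeD2l//.
rewrite ge0_integral_sum// -sumEFin; apply: lee_sum => n _.
rewrite ge0_integral_sum// -sumEFin; apply: lee_sum => l _.
have := sqnorm_sub_scales_le aP (fun m k => tensor_coef f l k) (sc2 n l) (fB2 n l).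
rewrite [X in (_ + X)%:E](_ : _ = 0) ?addr0//.
by apply: big1 => m _; apply: big1 => k _; rewrite subrr expr0n.
Qed.

End product_square_integrable.

Lemma powR2_opp_lt1 (R : realType) (sigma : R) : 0 < sigma -> 2 `^ (- (2 * sigma)) < 1.
Proof.
move=> sigma0; rewrite powRN invf_lt1 ?powR_gt0//.
by rewrite /powR pnatr_eq0 -[ltLHS]expR0 ltr_expR !mulr_gt0// ln_gt0// ltr1n.
Qed.

Section cardinals.

Lemma card_time_index n : (#|time_index n| <= 2 ^ n)%N.
Proof. by rewrite card_ord leq_exp2l// leq_pred. Qed.

Lemma card_space_index d n : (#|space_index d n| <= 2 ^ (n * d))%N.
Proof.
rewrite card_sig; case: n => [|n].
  rewrite mul0n expn0; apply/card_le1_eqP => -[e k] [e' k'].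
  rewrite !inE/= !eqb_id => /eqP-> /eqP->.
  congr (_, _); apply/ffunP => i.
  by apply/val_inj; case: (k i) (k' i) => -[|//] ? [[]].
rewrite (leq_trans (max_card _))// card_prod !card_ffun card_bool !card_ord.
by rewrite -expnM -expnD mulSn.
Qed.

Lemma sum_pow2_le d N : (0 < d)%N -> (\sum_(n < N) 2 ^ (n * d) <= 2 ^ (N * d))%N.
Proof.
move=> d0; elim: N => [|N IHN]; first by rewrite big_ord0.
rewrite big_ord_recr/= (leq_trans (leq_add IHN (leqnn _)))//.
by rewrite addnn -mul2n -expnS leq_exp2l// mulSn -add1n leq_add2r.
Qed.

End cardinals.

Section real_estimates.
Variable R : realType.

Lemma sum_geometric_tail_le (x C : R) (u : nat -> R) (N M : nat) :
  0 <= x < 1 -> 0 <= C -> (forall n, u n <= C * x ^+ n) ->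
  \sum_(N <= n < M) u n <= C / (1 - x) * x ^+ N.
Proof.
move=> /andP[x0 x1] C0 uC; have x1' : 0 < 1 - x by rewrite subr_gt0.
apply: (@le_trans _ _ (\sum_(N <= n < M) C * x ^+ n)); first exact: ler_sum.
rewrite -mulr_sumr -mulrA ler_wpM2l// ler_pdivlMl//.
have [NM|/ltnW MN] := leqP N M; last by rewrite big_geq// mulr0 exprn_ge0.
rewrite mulr_sumr (telescope_sumr_eq (fun n => - x ^+ n))//.
  by rewrite opprK addrC gerBl exprn_ge0.
by move=> n _; rewrite mulrBl mul1r -exprS opprK addrC.
Qed.

Lemma largest_int_dyadic (E : R) : 1 <= E ->
  exists2 j : int,
    largest_int (fun j => 2 ^ (j + 1) <= (Num.floor E)%:~R :> R) j &
    2 ^+ nscales j <= 2 * E /\ E < 2 ^+ nscales j.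
Proof.
move=> E1; have E0 : 0 <= E by lra.
have [f fE] : exists f : nat, Num.floor E = f%:Z.
  by exists `|Num.floor E|%N; rewrite gez0_abs// floor_ge0.
have f0 : (0 < f)%N by rewrite -ltz_nat -fE floor_gt0.
pose K := trunc_log 2 f.
have /andP[fle flt] := floor_itv E; rewrite fE intrD -!pmulrn in fle flt.
have jE : nscales (K%:Z - 1) = K.+1.
  by rewrite /nscales (_ : K%:Z - 1 + 2 = K.+1%:Z)// -addrA intS addrC.
have Kf : (2 ^ K <= f)%N by exact: trunc_logP.
have fK : (f < 2 ^ K.+1)%N by exact: trunc_log_ltn.
exists (K%:Z - 1); last first.
  rewrite jE; split.
    rewrite exprS ler_pM2l// (le_trans _ fle)//.
    by rewrite -natrX ler_nat.
  by rewrite (lt_le_trans flt)// -natrD -natrX ler_nat addn1.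
rewrite /largest_int subrK fE -pmulrn; split.
  by rewrite -exprnP -natrX ler_nat.
move=> k; rewrite lerBrDr.
case: (k + 1) => n; last by [].
rewrite -exprnP -natrX ler_nat => nf.
by rewrite lez_nat; exact: trunc_log_max.
Qed.
End real_estimates.

Section risk.
Variables (R : realType) (d : nat) (phi psi phit psit : R -> R).
Hypothesis spaceP : orthonormal_basis (lebesgue_cube R d)
  (fun i : {n : nat & space_index d n} => space_wavelet phi psi (tagged i)).
Hypothesis timeP : @orthonormal_basis _ (measurableTypeR R) _ (@lebesgue01 R)
  {n : nat & time_index n} (fun i => time_wavelet phit psit (tagged i)).
Local Notation T := (measurableTypeR R).
Local Notation X := (d.-tuple (measurableTypeR R)).
Context {dO : measure_display} {Omega : measurableType dO}.
Variables (P : probability Omega R) (W : (T * X -> R) -> {RV P >-> R}).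
Hypothesis WP : white_noise W.
Local Notation I := (space_index d).
Local Notation J := time_index.
Local Notation tensor := (tensor phi psi phit psit).

Lemma expectation_sqr_noise (g : T * X -> R) : g \in Lfun (lebesgueTX R d) 2%:E ->
  (\int[P]_w (W g w ^+ 2)%:E = (inner (lebesgueTX R d) g g)%:E)%E.
Proof.
move=> g2; have [_ _ <-//] := WP; rewrite unlock.
by apply: eq_integral.
Qed.

Lemma risk_bias_variance (eps : R) (j1 m2 : int) (f : T * X -> R) :
  f \in Lfun (lebesgueTX R d) 2%:E ->
  risk phi psi phit psit eps W j1 m2 f =
  (sqnorm (lebesgueTX R d) (fun z => f z - \sum_(n < nscales j1) \sum_(l : I n)
      \sum_(m < nscales m2) \sum_(k : J m)
        alphat phi psi phit psit f l k * tensor l k z)%R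
   + (eps ^+ 2 * ((\sum_(n < nscales j1) #|I n|) *
                  (\sum_(m < nscales m2) #|J m|))%N%:R)%:E)%E.
Proof.
move=> f2.
have [s2 so _] := spaceP; have [t2 to _] := timeP.
pose K := ({n : nat & I n} * {m : nat & J m})%type.
pose b (p : K) : T * X -> R := tensor (tagged p.1) (tagged p.2).
pose r : seq K := [seq (i, j) | i <- scales I (nscales j1), j <- scales J (nscales m2)].
have b2 p : b p \in Lfun (lebesgueTX R d) 2%:E.
  exact: (Lfun2_tensor (t2 p.2) (s2 p.1)).
have bo p q : inner (lebesgueTX R d) (b p) (b q) = (p == q)%:R.
  rewrite (inner_tensor_tensor (t2 p.2) (t2 q.2) (s2 p.1) (s2 q.1)) to so.
  by rewrite -natrM mulnb andbC.
have ur : uniq r.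
  by apply: allpairs_uniq; rewrite ?uniq_scales// => -[? ?] [].
have sumr (V : nmodType) (F : K -> V) : \sum_(p <- r) F p =
    \sum_(n < nscales j1) \sum_(l : I n) \sum_(m < nscales m2) \sum_(k : J m)
      F (Tagged I l, Tagged J k).
  rewrite big_allpairs sum_scales.
  by apply: eq_bigr => n _; apply: eq_bigr => l _; rewrite sum_scales.
have fb n (l : I n) m (k : J m) :
    alphat phi psi phit psit f l k = inner (lebesgueTX R d) f (tensor l k).
  rewrite innerC; apply/esym.
  exact: (inner_tensor f2 (t2 (Tagged J k)) (s2 (Tagged I l))).
have proj : sqnorm (lebesgueTX R d) (fun z => f z - \sum_(n < nscales j1) \sum_(l : I n)
      \sum_(m < nscales m2) \sum_(k : J m)
        alphat phi psi phit psit f l k * tensor l k z) =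
    (inner (lebesgueTX R d) f f
     - \sum_(p <- r) inner (lebesgueTX R d) f (b p) ^+ 2)%:E.
  rewrite -[X in X%:E]addr0.
  rewrite [X in (_ + X)%:E](_ : 0 = \sum_(p <- r) (inner (lebesgueTX R d) f (b p)
     - inner (lebesgueTX R d) f (b p)) ^+ 2); last first.
    by rewrite big1// => p _; rewrite subrr expr0n.
  rewrite -(sqnorm_sub_orthonormal _ ur b2 bo f2); congr sqnorm.
  apply/funext => z; congr (_ - _); rewrite sumr.
  apply: eq_bigr => n _; apply: eq_bigr => l _.
  by apply: eq_bigr => m _; apply: eq_bigr => k _; rewrite fb.
rewrite /risk.
under eq_integral => w _.
  rewrite (_ : sqnorm _ _ = (sqnorm (lebesgueTX R d)
      (fun z => f z - \sum_(p <- r) observation eps W f w (b p) * b p z)%R)); last first.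
    apply: eq_integral => z _; rewrite -sqrrN opprB; congr ((_ - _) ^+ 2)%:E.
    by rewrite sumr.
  rewrite (sqnorm_sub_orthonormal _ ur b2 bo f2) EFinD -proj.
  under eq_bigr do rewrite /observation innerC addrC addKr exprMn.
  rewrite -mulr_sumr EFinM -sumEFin.
  over.
have mW p : measurable_fun setT (fun w => (W (b p) w ^+ 2)%:E).
  by apply/measurable_EFinP/measurable_funX.
have W0 p w : (0 <= (W (b p) w ^+ 2)%:E)%E by rewrite lee_fin sqr_ge0.
have S0 w : (0 <= \sum_(p <- r) (W (b p) w ^+ 2)%:E)%E by exact: sume_ge0.
have mS : measurable_fun setT (fun w => \sum_(p <- r) (W (b p) w ^+ 2)%:E)%E.
  exact: emeasurable_sum.
have e0 : (0 <= (eps ^+ 2)%:E)%E by rewrite lee_fin sqr_ge0.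
rewrite ge0_integralD//; first last.
- exact: emeasurable_funM.
- by move=> w _; exact: mule_ge0.
- by move=> w _; exact: sqnorm_ge0.
rewrite integral_cst// (_ : _ setT = 1%E); last exact: (probability_setT P).
rewrite mule1 ge0_integralZl//.
rewrite ge0_integral_sum// [in RHS]EFinM; congr (_ + _)%E; congr (_ * _)%E.
under eq_bigr do rewrite expectation_sqr_noise// bo eqxx.
rewrite sumEFin sumr; congr EFin.
rewrite natrM !natr_sum mulr_suml; apply: eq_bigr => n _.
rewrite -[X in X%:R * _]sum1_card natr_sum mulr_suml; apply: eq_bigr => l _.
rewrite mul1r; apply: eq_bigr => m _.
by rewrite -sum1_card natr_sum.
Qed.

Lemma bias_le (s1 s2 : R) (p1 p2 q1 q2 : \bar R) (A1 A2 : R)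
    (A : forall n, I n -> R) (f : T * X -> R) (N1 N2 : nat) :
  0 < A1 -> (forall n (l : I n), 0 < A _ l) ->
  (\sum_(n <oo) \sum_(l : I n) ((A _ l) ^+ 2)%:E <= (A2 ^+ 2)%:E)%E ->
  0 < s1 -> 0 < s2 ->
  (2%:E <= p1)%E -> (2%:E <= q1)%E -> (2%:E <= p2)%E -> (2%:E <= q2)%E ->
  f \in besov_ball phi psi phit psit s1 s2 p1 p2 q1 q2 A1 A ->
  (sqnorm (lebesgueTX R d) (fun z => f z - \sum_(n < N1) \sum_(l : I n)
      \sum_(m < N2) \sum_(k : J m)
        alphat phi psi phit psit f l k * tensor l k z)%R
   <= (2 * 2 `^ (2 * (s1 + d%:R * (2^-1 - expinv p1))) * A1 ^+ 2 /
         (1 - 2 `^ (- (2 * s1))) * (2 `^ (- (2 * s1))) ^+ N1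
       + 2 * 2 `^ (2 * (s2 + 1 * (2^-1 - expinv p2))) /
         (1 - 2 `^ (- (2 * s2))) * A2 ^+ 2 * (2 `^ (- (2 * s2))) ^+ N2)%:E)%E.
Proof.
move=> A10 A0 AA2 s10 s20 p12 q12 p22 q22; rewrite inE => -[f2 _ fA1 fA].
have x01 (s : R) : 0 < s -> 0 <= 2 `^ (- (2 * s)) < 1.
  by move=> s0; rewrite powR_ge0 powR2_opp_lt1.
set x1 := 2 `^ (- (2 * s1)); set x2 := 2 `^ (- (2 * s2)).
set C1 := 2 * 2 `^ (2 * (s1 + _)) * A1 ^+ 2; set C2 := 2 * 2 `^ (2 * (s2 + _)).
have [x10 x11] := andP (x01 _ s10); have [x20 x21] := andP (x01 _ s20).
have C10 : 0 <= C1 by rewrite mulr_ge0 ?sqr_ge0// mulr_ge0 ?powR_ge0.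
have C20 : 0 <= C2 by rewrite mulr_ge0 ?powR_ge0.
have fA1t t : t \in `[0, 1] -> forall n,
    \sum_(l : I n) alpha phi psi f l t ^+ 2 <= C1 * x1 ^+ n.
  move=> t01; apply: (besov_norm_decay (D := d%:R) A10 p12 q12).
    move=> n; rewrite -natrM powR_mulrn// -natrX ler_nat.
    exact: card_space_index.
  by apply: le_trans fA1; apply: ereal_sup_ubound; exists t.
have fAl n (l : I n) m : \sum_(k : J m) alphat phi psi phit psit f l k ^+ 2 <=
    C2 * A _ l ^+ 2 * x2 ^+ m.
  apply: (besov_norm_decay (D := 1) (A0 _ l) p22 q22).
    move=> k; rewrite mulr1 powR_mulrn// -natrX ler_nat.
    exact: card_time_index.
  by rewrite mul1r addrA; exact: fA.
apply: le_trans.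
  apply: (@sqnorm_sub_projection_le _ _ _ _ _ (@lebesgue01 R) (lebesgue_cube R d)
    I J _ _ timeP spaceP f N1 N2 (C1 / (1 - x1) * x1 ^+ N1)
    (fun n l => C2 * A _ l ^+ 2 / (1 - x2) * x2 ^+ N2) f2).
  - by rewrite mulr_ge0 ?exprn_ge0// divr_ge0// subr_ge0 ltW.
  - exists (~` `[0, 1]); split.
    + by apply: measurableC.
    + by rewrite /= /lebesgue01 /mrestr setICl measure0.
    + move=> t /= nt t01; apply: nt => M.
      by apply: sum_geometric_tail_le; [exact: x01 | exact: C10 | exact: fA1t].
  - move=> n l M; apply: sum_geometric_tail_le; first exact: x01.
      by rewrite mulr_ge0 ?sqr_ge0.
    exact: fAl.
rewrite lee_fin lerD2l.
under eq_bigr do rewrite -!mulr_suml -mulr_sumr.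
rewrite -!mulr_suml -mulr_sumr ler_wpM2r ?exprn_ge0//.
rewrite [leRHS]mulrAC ler_wpM2r ?invr_ge0 ?subr_ge0 ?(ltW x21)// ler_wpM2l//.
rewrite -lee_fin (le_trans _ AA2)// -sumEFin.
under eq_bigr do rewrite -sumEFin.
rewrite -(big_mkord xpredT (fun n => \sum_(l : I n) (A _ l ^+ 2)%:E)%E).
apply: nneseries_lim_ge => n _ _; apply: sume_ge0 => l _.
by rewrite lee_fin sqr_ge0.
Qed.

End risk.

Lemma dyadic_bias_rate (R : realType) (e a sigma : R) (N : nat) :
  0 < e -> 0 < sigma -> e `^ (- a) < 2 ^+ N ->
  (2 `^ (- (2 * sigma))) ^+ N <= e `^ (2 * sigma * a).
Proof.
move=> e0 s0 aN; rewrite -powR_mulrn ?powR_ge0// -powRrM (mulrC _ N%:R) (powRrM 2) powR_mulrn//.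
have -> : 2 * sigma * a = - a * - (2 * sigma) by ring.
rewrite powRrM; have E0 : 0 < e `^ (- a) by exact: powR_gt0.
rewrite [leLHS]powRN [leRHS]powRN lef_pV2 ?posrE ?powR_gt0 ?exprn_gt0//.
have s20 : 0 <= 2 * sigma by rewrite mulr_ge0// ltW.
by apply: (ge0_ler_powR s20); rewrite ?nnegrE ?exprn_ge0// ltW.
Qed.

Lemma dyadic_variance_rate (R : realType) (e a1 a2 : R) (d N1 N2 : nat) :
  0 < e -> 2 ^+ N1 <= 2 * e `^ (- a1) -> 2 ^+ N2 <= 2 * e `^ (- a2) ->
  e ^+ 2 * (2 ^ (N1 * d) * 2 ^ N2)%N%:R <=
    2 ^+ d.+1 * e `^ (2 - (d%:R * a1 + a2)).
Proof.
move=> e0 N1e N2e; rewrite natrM !natrX exprM.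
apply: (@le_trans _ _ (e ^+ 2 * ((2 * e `^ (- a1)) ^+ d * (2 * e `^ (- a2))))).
  rewrite ler_wpM2l ?sqr_ge0// ler_pM ?exprn_ge0//.
  by rewrite lerXn2r ?nnegrE ?exprn_ge0// mulr_ge0 ?powR_ge0.
rewrite exprMn -(powR_mulrn 2 (ltW e0)) -(powR_mulrn d (powR_ge0 e _)) -powRrM.
have e_ (x y : R) : e `^ x * e `^ y = e `^ (x + y).
  by rewrite powRD// (gt_eqF e0) implybT.
have -> : 2 - (d%:R * a1 + a2) = 2 + (- a1 * d%:R + - a2) by ring.
by rewrite -!e_ exprS le_eqVlt; apply/orP; left; apply/eqP; ring.
Qed.

Theorem theorem2 (R : realType) (d : nat) (hd : (0 < d)%N)
  (tau1 tau2 : nat) (phi psi phit psit : R -> R)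
  (hX : space_wavelet_basis phi psi d tau1)
  (hT : time_wavelet_basis phit psit tau2)
  (A1 A2 : R) (hA1 : 0 < A1) (hA2 : 0 < A2)
  (A : forall n, space_index d n -> R)
  (hA : forall n (l : space_index d n), 0 < A n l)
  (hAsum : (\sum_(n <oo) \sum_(l : space_index d n) ((A n l) ^+ 2)%:E
              <= (A2 ^+ 2)%:E)%E)
  (s1 s2 : R) (hs1 : 0 < s1 < tau1%:R) (hs2 : 0 < s2 < tau2%:R)
  (p1 q1 p2 q2 : \bar R)
  (hp1 : (2%:E <= p1)%E) (hq1 : (2%:E <= q1)%E)
  (hp2 : (2%:E <= p2)%E) (hq2 : (2%:E <= q2)%E)
  (hw1 : 0 < s1 + d%:R * (2^-1 - expinv p1))
  (hw2 : 0 < s2 + 2^-1 - expinv p2)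
  (s : R) (hs : 0 < s) (hsE : s^-1 = (d%:R + 1)^-1 * (d%:R / s1 + s2^-1)) :
  exists C : R, 0 < C /\
    \forall eps \near 0^'+, exists j1 m2 : int,
      [/\ largest_int (fun j => 2 ^ (j + 1) <=
            (Num.floor (eps `^ (- (2 * s / ((2 * s + d%:R + 1) * s1)))))%:~R :> R)
            j1,
          largest_int (fun m => 2 ^ (m + 1) <=
            (Num.floor (eps `^ (- (2 * s / ((2 * s + d%:R + 1) * s2)))))%:~R :> R)
            m2 &
          forall (dO : measure_display) (Omega : measurableType dO)
            (P : probability Omega R)
            (W : (measurableTypeR R * d.-tuple (measurableTypeR R) -> R) ->
                 {RV P >-> R}),
            white_noise W ->
            (ereal_sup [set risk phi psi phit psit eps W j1 m2 f
                       | f in besov_ball phi psi phit psit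
                                s1 s2 p1 p2 q1 q2 A1 A]
             <= (C * eps `^ (4 * s / (2 * s + d%:R + 1)))%:E)%E].
Proof.
have [_ spaceP] := hX; have [_ timeP] := hT.
have [s10 _] := andP hs1; have [s20 _] := andP hs2.
set K := 2 * s + d%:R + 1.
have d0 : 0 < d%:R :> R by rewrite ltr0n.
have K0 : 0 < K by rewrite /K; lra.
set a1 := 2 * s / (K * s1); set a2 := 2 * s / (K * s2); set r := 4 * s / K.
have a10 : 0 < a1 by rewrite divr_gt0 ?mulr_gt0.
have a20 : 0 < a2 by rewrite divr_gt0 ?mulr_gt0.
have s0' : s != 0 by rewrite gt_eqF.
have s10' : s1 != 0 by rewrite gt_eqF.
have s20' : s2 != 0 by rewrite gt_eqF.
have K0' : K != 0 by rewrite gt_eqF.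
have r1 : 2 * s1 * a1 = r by rewrite /r /a1; field; rewrite K0' s10'.
have r2 : 2 * s2 * a2 = r by rewrite /r /a2; field; rewrite K0' s20'.
have rv : 2 - (d%:R * a1 + a2) = r.
  have -> : d%:R * a1 + a2 = 2 * s / K * (d%:R / s1 + s2^-1).
    by rewrite /a1 /a2; field; rewrite ?K0' s10' s20'.
  have -> : d%:R / s1 + s2^-1 = (d%:R + 1) / s.
    by rewrite hsE mulrA divff ?mul1r// gt_eqF// addr_gt0.
  rewrite /r; apply: (mulIf K0'); rewrite mulrBl.
  have -> : 2 * s / K * ((d%:R + 1) / s) * K = 2 * (d%:R + 1).
    by field; rewrite ?K0' s0'.
  by rewrite divfK// /K; ring.
pose x1 : R := 2 `^ (- (2 * s1)); pose x2 : R := 2 `^ (- (2 * s2)).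
pose D1 := 2 * 2 `^ (2 * (s1 + d%:R * (2^-1 - expinv p1))) * A1 ^+ 2 / (1 - x1).
pose D2 := 2 * 2 `^ (2 * (s2 + 1 * (2^-1 - expinv p2))) / (1 - x2) * A2 ^+ 2.
have D10 : 0 <= D1.
  apply: divr_ge0; last by rewrite subr_ge0 ltW// powR2_opp_lt1.
  by apply: mulr_ge0; rewrite ?sqr_ge0// mulr_ge0 ?powR_ge0.
have D20 : 0 <= D2.
  apply: mulr_ge0; last exact: sqr_ge0.
  by apply: divr_ge0; [rewrite mulr_ge0 ?powR_ge0 | rewrite subr_ge0 ltW// powR2_opp_lt1].
exists (D1 + D2 + 2 ^+ d.+1); split; first by rewrite ltr_wpDl ?addr_ge0// exprn_gt0.
near=> e.
have e0 : 0 < e by near: e; exact: nbhs_right_gt.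
have e1 : e < 1 by near: e; exact: nbhs_right_lt.
have E1 (a : R) : 0 < a -> 1 <= e `^ (- a).
  move=> a0; rewrite powRN invf_ge1 ?powR_gt0// -(powRr0 e).
  by rewrite ger_powR ?e0 ?ltW.
have [j1 j1P [N1u N1l]] := largest_int_dyadic (E1 _ a10).
have [m2 m2P [N2u N2l]] := largest_int_dyadic (E1 _ a20).
exists j1, m2; split => // dO Omega P W WP.
apply: ge_ereal_sup => _ [f fB <-].
have [f2 _ _ _] := fB.
rewrite (risk_bias_variance spaceP timeP WP)//.
have fB' : f \in besov_ball phi psi phit psit s1 s2 p1 p2 q1 q2 A1 A by rewrite inE.
apply: le_trans (leeD2r _ (bias_le spaceP timeP (nscales j1) (nscales m2)
  hA1 hA hAsum s10 s20 hp1 hq1 hp2 hq2 fB')) _.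
rewrite -EFinD lee_fin -/x1 -/x2 -/D1 -/D2 !mulrDl.
apply: lerD; first apply: lerD.
- by rewrite ler_wpM2l// -r1; exact: dyadic_bias_rate.
- by rewrite ler_wpM2l// -r2; exact: dyadic_bias_rate.
rewrite -rv; apply: le_trans (dyadic_variance_rate d e0 N1u N2u).
rewrite ler_wpM2l ?sqr_ge0// ler_nat leq_mul//.
  apply: leq_trans (sum_pow2_le _ hd); apply: leq_sum => n _.
  exact: card_space_index.
rewrite -[X in (_ <= 2 ^ X)%N]muln1; apply: leq_trans (sum_pow2_le _ (ltn0Sn 0)).
by apply: leq_sum => n _; rewrite muln1 card_time_index.
Unshelve. all: by end_near.
Qed.
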